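(* There is a numerical constant $c$ such that the following holds. Suppose that there are $B,\eta>0$ such that for all $y\in\mathcal{Y}$ the function $\ell(\cdot,y)$ is $\eta$-exp-concave on $\mathcal{X}$ and $\sup_{x,x'\in\mathcal{X}}|\ell(x,y)-\ell(x',y)|\le B$. Consider the case $p=m=2$ and $\mathrm{IC}=\mathrm{True}$. For any input parameter $\lambda\in\left(0,\frac{\bar\lambda}{352K^2}\right)$ and any $\delta\in(0,1)$, the regret of the algorithm described in the context, run with parameter $\lambda$, satisfies with probability at least $1-8\delta$ with respect to the player's own randomization $$\mathcal{R}_T\le c\left(\frac1\lambda+\frac{K}{\bar\lambda}\right)\log\left(\frac{\bar\lambda K}{\lambda\delta}\right).$$
   Context: Write $[n]=\{1,\dots,n\}$. $\mathcal{X}$ is a closed convex subset of a real vector space, $\mathcal{Y}$ an outcome space, $\ell:\mathcal{X}\times\mathcal{Y}\to\mathbb{R}$ a loss function; $f$ is $\eta$-exp-concave if $\exp(-\eta f)$ is concave. Fixed (deterministic, unknown to the learner) sequences are given: outcomes $y_t\in\mathcal{Y}$ and expert predictions $F_{i,t}\in\mathcal{X}$, for $i\in[K]$, $t\in[T]$. Put $\ell_{i,t}=\ell(F_{i,t},y_t)$. If the learner plays $z_t\in\mathcal{X}$ at round $t$, its regret is $\mathcal{R}_T=\sum_{t=1}^T\ell(z_t,y_t)-\min_{i\in[K]}\sum_{t=1}^T\ell_{i,t}$. In each round the learner may combine $p=2$ experts for its prediction and observe the losses of at most $m=2$ experts; $\mathrm{IC}=\mathrm{True}$ means that the experts used for prediction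 are required to be among the observed ones. Define $$\bar\lambda:=\min\left\{\frac{4\log\left(1+\frac{\eta^2B^2}{2}\right)}{\eta B^2},\ \frac1B\right\}.$$ Algorithm (input $\lambda$): set $\hat L_{i,0}=\hat V_{i,0}=0$ for all $i\in[K]$. At each round $t=1,2,\dots$: let $$\hat p_{i,t}=\frac{\exp\left(-\lambda\hat L_{i,t-1}+\lambda^2\hat V_{i,t-1}\right)}{\sum_{j=1}^K\exp\left(-\lambda\hat L_{j,t-1}+\lambda^2\hat V_{j,t-1}\right)};$$ sample $A_t$ from $[K]$ according to $\hat p_t$ and, independently, $B_t$ from $[K]$ uniformly at random (possibly $A_t=B_t$); let $C_t=\{A_t,B_t\}$; for $i\in C_t$ let $$\hat q_{i,t}=\frac{\exp\left(-\lambda\hat L_{i,t-1}+\lambda^2\hat V_{i,t-1}\right)}{\sum_{j\in C_t}\exp\left(-\lambda\hat L_{j,t-1}+\lambda^2\hat V_{j,t-1}\right)};$$ draw $I_t$ and $J_t$ from $C_t$ according to $\hat q_t$, independently of each other conditionally on $C_t$ and the past; play $z_t=\frac12F_{I_t,t}+\frac12F_{J_t,t}$ and incur its loss; observe $\ell_{i,t}$ for $i\in C_t$; for every $i\in[K]$ let $$\hat\ell_{i,t}=K\,\mathbf{1}(B_t=i)\,\ell_{i,t}+\left(1-K\,\mathbf{1}(B_t=i)\right)\ell_{A_t,t},\qquad\hat v_{i,t}=\left(\hat\ell_{i,t}-\ell_{A_t,t}\right)^2,$$ and update $\hat L_{i,t}=\hat L_{i,t-1}+\hat\ell_{i,t}$,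 $\hat V_{i,t}=\hat V_{i,t-1}+\hat v_{i,t}$. *)

(* Defs.v *)
From HB Require Import structures.
From mathcomp Require Import all_boot all_order all_algebra.
From mathcomp Require Import all_classical all_reals all_analysis.

Set Implicit Arguments.
Unset Strict Implicit.
Unset Printing Implicit Defensive.

Import Order.TTheory GRing.Theory Num.Theory.

Local Open Scope classical_set_scope.
Local Open Scope ring_scope.

Definition concave_function (R : realType) (E : lmodType R)
    (D : set (convex_lmodType E)) (f : convex_lmodType E -> R) : Prop :=
  convex_function D (fun x => - f x).

Definition exp_concave (R : realType) (E : lmodType R) (eta : R)
    (D : set (convex_lmodType E)) (f : convex_lmodType E -> R) : Prop :=
  concave_function D (fun x => expR (- (eta * f x))).

Definition lambda_bar (R : realType) (eta B : R) : R :=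
  Num.min (4 * ln (1 + eta ^+ 2 * B ^+ 2 / 2) / (eta * B ^+ 2)) (1 / B).

(* The set [K] of experts is 'I_n.+1, so that K = n.+1 is positive, and the
   set [T] of rounds is 'I_T (rounds are numbered from 0). *)
Section Algorithm.
Variables (R : realType) (n T : nat).

(* The draws ((A_t, B_t), (I_t, J_t)) of one round. *)
Definition draws : Type := (('I_n.+1 * 'I_n.+1) * ('I_n.+1 * 'I_n.+1))%type.

(* The player's randomization over the T rounds. *)
Definition trajectory : Type := {ffun 'I_T -> draws}.

Definition drawA (w : trajectory) (t : 'I_T) : 'I_n.+1 := (w t).1.1.
Definition drawB (w : trajectory) (t : 'I_T) : 'I_n.+1 := (w t).1.2.
Definition drawI (w : trajectory) (t : 'I_T) : 'I_n.+1 := (w t).2.1.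
Definition drawJ (w : trajectory) (t : 'I_T) : 'I_n.+1 := (w t).2.2.

Definition observed (w : trajectory) (t : 'I_T) : {set 'I_n.+1} :=
  [set drawA w t; drawB w t]%SET.

(* [l i t] is the loss of expert i at round t. *)
Variables (l : 'I_n.+1 -> 'I_T -> R) (lambda : R).

Definition loss_est (w : trajectory) (i : 'I_n.+1) (t : 'I_T) : R :=
  n.+1%:R * (drawB w t == i)%:R * l i t
  + (1 - n.+1%:R * (drawB w t == i)%:R) * l (drawA w t) t.

Definition var_est (w : trajectory) (i : 'I_n.+1) (t : 'I_T) : R :=
  (loss_est w i t - l (drawA w t) t) ^+ 2.

(* The updates of the cumulative estimates are written as sums: these are the
   values at the beginning of round t, after the updates of the rounds s < t. *)
Definition cum_loss_est (w : trajectory) (i : 'I_n.+1) (t : 'I_T) : R :=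
  \sum_(s < T | (s < t)%N) loss_est w i s.

Definition cum_var_est (w : trajectory) (i : 'I_n.+1) (t : 'I_T) : R :=
  \sum_(s < T | (s < t)%N) var_est w i s.

Definition weight (w : trajectory) (t : 'I_T) (i : 'I_n.+1) : R :=
  expR (- lambda * cum_loss_est w i t + lambda ^+ 2 * cum_var_est w i t).

Definition p_hat (w : trajectory) (t : 'I_T) (i : 'I_n.+1) : R :=
  weight w t i / \sum_(j < n.+1) weight w t j.

Definition q_hat (w : trajectory) (t : 'I_T) (i : 'I_n.+1) : R :=
  if i \in observed w t
  then weight w t i / \sum_(j in observed w t) weight w t j
  else 0.

(* The conditional probability, given the draws of the rounds s < t, of the
   draws made at round t along w: A_t and B_t are independent with respective
   laws p_hat and uniform, and then I_t and J_t are independent with law q_hat. *)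
Definition step_mass (w : trajectory) (t : 'I_T) : R :=
  p_hat w t (drawA w t) * n.+1%:R^-1
  * (q_hat w t (drawI w t) * q_hat w t (drawJ w t)).

Definition run_mass (w : trajectory) : R := \prod_(t < T) step_mass w t.

Definition run_prob (event : pred trajectory) : R :=
  \sum_(w | event w) run_mass w.

Lemma run_mass_ge0 (w : trajectory) : 0 <= run_mass w.
Proof.
have pos v t i : 0 <= weight v t i by exact: expR_ge0.
have q0 v t i : 0 <= q_hat v t i.
  by rewrite /q_hat; case: ifP => // _; apply: divr_ge0 => //; exact: sumr_ge0.
apply: prodr_ge0 => t _; rewrite /step_mass; apply: mulr_ge0.
  by rewrite mulr_ge0 ?invr_ge0 ?ler0n// divr_ge0//; exact: sumr_ge0.
exact: mulr_ge0.
Qed.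

Definition set_draws (w : trajectory) (t : 'I_T) (d : draws) : trajectory :=
  [ffun s => if s == t then d else w s].

Lemma weight_past (w w' : trajectory) (t : 'I_T) :
  (forall s : 'I_T, (s < t)%N -> w s = w' s) -> weight w t =1 weight w' t.
Proof.
move=> ww' i.
have e (s : 'I_T) : (s < t)%N -> loss_est w i s = loss_est w' i s.
  by move=> st; rewrite /loss_est /drawA /drawB ww'.
rewrite /weight; have -> : cum_loss_est w i t = cum_loss_est w' i t.
  exact: eq_bigr.
have -> // : cum_var_est w i t = cum_var_est w' i t.
by apply: eq_bigr => s st; rewrite /var_est e// /drawA ww'.
Qed.

Lemma step_mass_past (w w' : trajectory) (t : 'I_T) :
  (forall s : 'I_T, (s <= t)%N -> w s = w' s) -> step_mass w t = step_mass w' t.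
Proof.
move=> ww'; have ew : weight w t =1 weight w' t.
  by apply: weight_past => s /ltnW; exact: ww'.
rewrite /step_mass /p_hat /q_hat /observed /drawA /drawB /drawI /drawJ.
rewrite ww'// !ew (eq_bigr _ (fun i _ => ew i)).
by rewrite (eq_bigr _ (fun i _ => ew i)).
Qed.

Lemma sum_step_mass (w : trajectory) (t : 'I_T) :
  \sum_(d : draws) step_mass (set_draws w t d) t = 1.
Proof.
pose u := weight w t.
have u0 i : 0 < u i by exact: expR_gt0.
have ew d : weight (set_draws w t d) t =1 u.
  by apply: weight_past => s st; rewrite ffunE -val_eqE/= ltn_eqF.
pose C (ab : 'I_n.+1 * 'I_n.+1) : {set 'I_n.+1} := [set ab.1; ab.2]%SET.
pose q ab i := if i \in C ab then u i / \sum_(j in C ab) u j else 0.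
have q1 ab : \sum_i q ab i = 1.
  rewrite /q -big_mkcond -mulr_suml divff// gt_eqF//.
  rewrite (bigD1 ab.1) ?inE ?eqxx//= ltr_pwDl//.
  by apply: sumr_ge0 => i _; exact: ltW.
have p1 : \sum_i u i / \sum_j u j = 1.
  rewrite -mulr_suml divff// gt_eqF// (bigD1 ord0)//= ltr_pwDl//.
  by apply: sumr_ge0 => i _; exact: ltW.
transitivity (\sum_(d : draws)
   (u d.1.1 / (\sum_j u j) * n.+1%:R^-1) * (q d.1 d.2.1 * q d.1 d.2.2)).
  apply: eq_bigr => d _.
  rewrite /step_mass /p_hat /q_hat /observed /drawA /drawB /drawI /drawJ.
  rewrite !ffunE eqxx !ew (eq_bigr _ (fun i _ => ew d i)).
  by rewrite (eq_bigr _ (fun i _ => ew d i)).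
rewrite -(pair_bigA _ (fun ab ij =>
   (u ab.1 / (\sum_j u j) * n.+1%:R^-1) * (q ab ij.1 * q ab ij.2)))/=.
transitivity (\sum_(ab : 'I_n.+1 * 'I_n.+1) u ab.1 / (\sum_j u j) * n.+1%:R^-1 : R).
  apply: eq_bigr => ab _; rewrite -mulr_sumr.
  rewrite -(pair_bigA _ (fun i j => q ab i * q ab j))/=.
  rewrite -[RHS]mulr1 -(q1 ab); congr (_ * _); apply: eq_bigr => i _.
  by rewrite -mulr_sumr q1 mulr1.
rewrite -(pair_bigA _ (fun a b => u a / (\sum_j u j) * n.+1%:R^-1))/=.
rewrite -[RHS]p1; apply: eq_bigr => a _.
by rewrite sumr_const card_ord -[LHS]mulr_natr mulfVK ?pnatr_eq0.
Qed.

Lemma run_mass_sum : \sum_(w : trajectory) run_mass w = 1.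
Proof.
pose d0 : draws := ((ord0, ord0), (ord0, ord0)).
pose P (m : nat) (w : trajectory) := [forall s : 'I_T, (m <= s)%N ==> (w s == d0)].
suff H m : (m <= T)%N ->
    \sum_(w | P m w) \prod_(t < T | (t < m)%N) step_mass w t = 1.
  rewrite -[RHS](H T)//; apply: eq_big => [w|w _].
    by apply/esym/forallP => s; rewrite leqNgt ltn_ord.
  by apply: eq_bigl => t; rewrite ltn_ord.
elim: m => [_|m IH mT].
  rewrite (big_pred1 [ffun=> d0]) ?big_pred0// => w /=.
  apply/forallP/eqP => [w0|-> s]; last by rewrite ffunE eqxx.
  by apply/ffunP => s; rewrite ffunE; apply/eqP; exact: (w0 s).
pose t0 := Ordinal mT; rewrite -[RHS](IH (ltnW mT)).
rewrite (partition_big (fun w => set_draws w t0 d0) (P m)) /=; last first.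
  move=> w /forallP Pw; apply/forallP => s; apply/implyP => ms; rewrite ffunE.
  case: (eqVneq s t0) => // st; apply: (implyP (Pw s)).
  by rewrite ltn_neqAle ms andbT eq_sym.
apply: eq_bigr => v /forallP Pv.
have vt0 : v t0 = d0 by apply/eqP; apply: (implyP (Pv t0)).
rewrite (reindex_onto (set_draws v t0) (fun w => w t0)) /=; last first.
  move=> w /andP[_ /eqP <-]; apply/ffunP => s; rewrite !ffunE.
  by case: (eqVneq s t0) => // ->.
transitivity (\sum_(d : draws) step_mass (set_draws v t0 d) t0
   * \prod_(t < T | (t < m)%N) step_mass v t); last first.
  by rewrite -mulr_suml sum_step_mass mul1r.
apply: eq_big => [d|d _].
  rewrite !ffunE !eqxx andbT; apply/andP; split.
    apply/forallP => s; apply/implyP => ms; rewrite ffunE.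
    case: (eqVneq s t0) => [st|_]; first by rewrite st ltnn in ms.
    by apply: (implyP (Pv s)); exact: ltnW.
  by apply/eqP/ffunP => s; rewrite !ffunE; case: (eqVneq s t0) => // ->.
rewrite (bigD1 t0)//=; congr (_ * _); apply: eq_big => [t|t].
  by rewrite -val_eqE /= ltnS ltn_neqAle andbC.
rewrite -val_eqE /= ltnS => /andP[tm tm'].
apply: step_mass_past => s st; rewrite ffunE ifF//.
apply/negbTE; rewrite -val_eqE /= ltn_eqF// (leq_ltn_trans st)//.
by rewrite ltn_neqAle tm' tm.
Qed.

Lemma run_prob_predT : run_prob predT = 1.
Proof. exact: run_mass_sum. Qed.

End Algorithm.

Section Regret.
Variables (R : realType) (E : lmodType R) (Y : Type) (loss : E -> Y -> R).
Variables (n T : nat) (y : 'I_T -> Y) (F : 'I_n.+1 -> 'I_T -> E).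

Definition expert_loss (i : 'I_n.+1) (t : 'I_T) : R := loss (F i t) (y t).

Definition play (w : trajectory n T) (t : 'I_T) : E :=
  2^-1 *: F (drawI w t) t + 2^-1 *: F (drawJ w t) t.

Definition regret (w : trajectory n T) : R :=
  \sum_(t < T) loss (play w t) (y t)
  - \big[Num.min / \sum_(t < T) expert_loss ord0 t]_(i < n.+1)
      \sum_(t < T) expert_loss i t.

End Regret.

(* Main.v *)
Require Import Defs.
From HB Require Import structures.
From mathcomp Require Import all_boot all_order all_algebra.
From mathcomp Require Import all_classical all_reals all_analysis.
From mathcomp Require Import ring lra.

Set Implicit Arguments.
Unset Strict Implicit.
Unset Printing Implicit Defensive.

Import Order.TTheory GRing.Theory Num.Theory.

Local Open Scope classical_set_scope.
Local Open Scope ring_scope.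

(** Two effects balance in every round. Let [p] be the weights [p_hat] of the
    round, [K] the number of experts and [mu = lambda_bar / 16].

    The pair [(A, B)] has [A] drawn from [p] and [B] uniform, and [I], [J] are
    drawn from the pair in proportion to [p]; the marginal law of [I] is then
    [p] itself, so that playing [I] alone would cost the [p]-average of the
    losses. Playing the midpoint of [I] and [J] instead saves
    [mu * (l_I - l_J) ^+ 2] by exp-concavity ([midpoint_exp_concave]), in
    expectation [mu / K * H] where [H] is the sum of
    [p_a * p_b / (p_a + p_b) * (l_a - l_b) ^+ 2]. On the other side, the
    exponential weights pay second-order terms of the importance-weighted
    estimates, of expectation at most a constant times [lambda * K * H]. As
    [lambda * K ^+ 2] is at most [lambda_bar / 352 = mu / 22], the saving wins.

    High probability comes from exponential moments, round by round. Let [k] be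
    the best expert, [growth] the factor by which a round multiplies the weight
    of an expert and [potential_ratio] its [p]-average. Both
    [expR (lambda * loss of the play) * potential_ratio] and
    [expR (- lambda * l_k) / growth of k] have conditional expectation at most 1
    ([learner_round_le], [expert_round_le]); for the second, the correction
    [lambda ^+ 2 * var_est] in the weights is exactly what absorbs the variance
    of the loss estimate of [k]. Their half-sum [round_factor] has the same
    property, hence the product [M] of these over all rounds has expectation at
    most 1 ([sum_prod_past_le1]). By the inequality between the arithmetic and
    geometric means [M ^+ 2] dominates the product of both families, in which
    the growth factors telescope ([prod_growth_le]), leaving
    [expR (lambda * regret) <= K * M ^+ 2] ([prod_round_factor_ge]). Markov's
    inequality for [M] gives, with probability at least [1 - delta], a regret of
    at most [(ln K + 2 * ln (1 / delta)) / lambda] ([regret_tail]), so that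
    [c = 2] is enough. *)

(** * Exponential inequalities *)

Lemma expR_le_inv (R : realType) (x : R) : x < 1 -> expR x <= (1 - x)^-1.
Proof.
move=> x1; rewrite -[x in expR x]opprK expRN lef_pV2 ?posrE ?expR_gt0 ?subr_gt0//.
exact: expR_ge1Dx.
Qed.

Lemma expR_le_quad (R : realType) (x : R) :
  x <= 1 / 6 -> expR x <= 1 + x + 6 / 5 * x ^+ 2.
Proof.
move=> x6; apply: (le_trans (expR_le_inv _)); first by lra.
rewrite -[leLHS]mul1r ler_pdivrMr; last by lra.
have -> : (1 + x + 6 / 5 * x ^+ 2) * (1 - x) = 1 + x ^+ 2 * (1 / 5 - 6 / 5 * x).
  by field.
by rewrite lerDl mulr_ge0 ?sqr_ge0//; lra.
Qed.

Lemma expR_add_sqr_le (R : realType) (x : R) : `|x| <= 1 / 100 ->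
  expR (- x + x ^+ 2) <= 1 - x + 3 * x ^+ 2.
Proof.
rewrite ler_norml => /andP[x1 x2]; apply: (le_trans (expR_le_quad _)); first nra.
have -> : 1 + (- x + x ^+ 2) + 6 / 5 * (- x + x ^+ 2) ^+ 2 =
  1 - x + x ^+ 2 * (1 + 6 / 5 * (1 - x) ^+ 2) by field.
by rewrite lerD2l mulrC ler_wpM2r ?sqr_ge0//; nra.
Qed.

(** The coefficient 1 of [x ^+ 2] leaves room over 1/2, the second-order
    coefficient of [expR]; bounding [expR] of half the argument and squaring is
    precise enough to see it, whereas [expR_le_inv] alone is not. *)
Lemma expR_sub_sqr_le (R : realType) (x : R) : `|x| <= 1 / 100 ->
  expR (x - x ^+ 2) <= 1 + x.
Proof.
rewrite ler_norml => /andP[x1 x2].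
have -> : x - x ^+ 2 = 2%:R * ((x - x ^+ 2) / 2) by field.
have y1 : (x - x ^+ 2) / 2 < 1 by nra.
rewrite expRM_natl; apply: (@le_trans _ _ ((1 - (x - x ^+ 2) / 2)^-1 ^+ 2)).
  apply: lerXn2r; rewrite ?nnegrE ?expR_ge0//; last exact: expR_le_inv.
  by rewrite invr_ge0 subr_ge0 ltW.
rewrite exprVn -[leLHS]mul1r ler_pdivrMr; last by rewrite exprn_gt0// subr_gt0.
have -> : (1 + x) * (1 - (x - x ^+ 2) / 2) ^+ 2 =
  1 + x ^+ 2 * (x + (1 - x) ^+ 2 * (1 + x) / 4) by field.
by rewrite lerDl mulr_ge0 ?sqr_ge0//; nra.
Qed.

(** Mean value theorem: the derivative of the difference of both sides is
    [expR x + expR (- x) - 2], which is nonnegative. *)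
Lemma sinh_ge (R : realType) (x : R) : 0 <= x -> 2 * x <= expR x - expR (- x).
Proof.
move=> x0; pose f (z : R) := expR z - expR (- z) - 2 * z.
pose f' (z : R) := expR z + expR (- z) - 2.
have df (z : R) : is_derive z 1 f (f' z).
  apply: is_derive_eq; rewrite /GRing.scale/= /f'; ring.
have fc : {within `[0, x], continuous f}.
  by apply: derivable_within_continuous => z _; exact: ex_derive.
have [z /[!in_itv]/= /andP[z0 _]] := MVT_segment x0 (fun z _ => df z) fc.
rewrite {1 2}/f oppr0 mulr0 subr0 subrr !subr0 => e.
rewrite -subr_ge0 e mulr_ge0 ?addr0// /f'.
by have := expR_ge1Dx z; have := expR_ge1Dx (- z); lra.
Qed.

(** [cosh h - 1] is twice the square of [sinh (h / 2)]. *)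
Lemma cosh_ge (R : realType) (h : R) : 1 + h ^+ 2 / 2 <= (expR h + expR (- h)) / 2.
Proof.
wlog h0 : h / 0 <= h => [H|].
  have [|/ltW h0] := leP 0 h; first exact: H.
  by have := H (- h); rewrite sqrrN opprK oppr_ge0 [_ + expR h]addrC; exact.
have H : 2 * (h / 2) <= expR (h / 2) - expR (- (h / 2)) by apply: sinh_ge; lra.
have e1 : expR h = expR (h / 2) ^+ 2 by rewrite -expRM_natl; congr expR; field.
have e2 : expR (- h) = expR (- (h / 2)) ^+ 2 by rewrite -expRM_natl; congr expR; field.
have e3 := expRxMexpNx_1 (h / 2).
rewrite e1 e2; nra.
Qed.

(** Concavity of [ln] between 1 and [1 + s]. *)
Lemma ln1D_ge (R : realType) (s t : R) : 0 <= s -> 0 <= t -> t <= 1 ->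
  t * ln (1 + s) <= ln (1 + t * s).
Proof.
move=> s0 t0 t1.
have := concave_ln (Itv01 t0 t1) (_ : 0 < 1 + s) (@ltr01 R).
rewrite !convRE/= ln1 mulr0 addr0 => /(_ _)/le_trans; apply; first by lra.
by rewrite le_eqVlt; apply/orP; left; apply/eqP; congr ln; rewrite /unstable.onem; ring.
Qed.

(** * The gain of a midpoint under exp-concavity *)

(** With [a = f x] and [b = f x'], exp-concavity at the midpoint yields a gain of
    [ln (cosh (eta * (a - b) / 2)) / eta] over the mean of [a] and [b]. As a
    function of [(a - b) ^+ 2] the lower bound obtained from [cosh_ge] is concave,
    so the chord up to [4 * B ^+ 2] turns it into a multiple of [(a - b) ^+ 2]:
    this is where the logarithm in [lambda_bar] comes from. *)
Lemma midpoint_exp_concave (R : realType) (E : lmodType R) (X : set E)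
    (f : E -> R) (B eta : R) (x x' : E) :
  0 < B -> 0 < eta -> exp_concave eta X f -> X x -> X x' ->
  `|f x - f x'| <= B ->
  f (2^-1 *: x + 2^-1 *: x') <=
    (f x + f x') / 2 - lambda_bar eta B / 16 * (f x - f x') ^+ 2.
Proof.
move=> B0 eta0 cf Xx Xx' fB.
have h0 : (0 : R) <= 2^-1 by lra.
have h1 : (2^-1 : R) <= 1 by lra.
have := cf (Itv01 h0 h1) x x'; rewrite !inE => /(_ Xx Xx').
rewrite convRE /conv/= /unstable.onem (_ : 1 - 2^-1 = 2^-1); last by field.
set m := f _; set a := f x; set b := f x' => H.
have {}H : expR (- (eta * ((a + b) / 2))) * (1 + (eta * (a - b) / 2) ^+ 2 / 2)
    <= expR (- (eta * m)).
  apply: (@le_trans _ _ ((expR (- (eta * a)) + expR (- (eta * b))) / 2)); last by lra.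
  have -> : - (eta * a) = - (eta * ((a + b) / 2)) + - (eta * (a - b) / 2) by field.
  have -> : - (eta * b) = - (eta * ((a + b) / 2)) + (eta * (a - b) / 2) by field.
  rewrite !expRD -mulrDr -[leRHS]mulrA ler_wpM2l ?expR_ge0//.
  by rewrite [X in _ <= X / 2]addrC; exact: cosh_ge.
(* This [t] turns [eta ^+ 2 * B ^+ 2 / 2], the quantity in [lambda_bar], into
   the quadratic term of [cosh]. *)
pose t := (a - b) ^+ 2 / (4 * B ^+ 2).
have B2 : 0 < B ^+ 2 by rewrite exprn_gt0.
have tE : t * (4 * B ^+ 2) = (a - b) ^+ 2 by rewrite /t mulfVK// mulf_neq0// gt_eqF.
have ab2 : (a - b) ^+ 2 <= B ^+ 2.
  by rewrite -[leLHS]real_normK ?num_real// lerXn2r// ?nnegrE// ltW.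
have t0 : 0 <= t by rewrite /t divr_ge0 ?sqr_ge0// ltW// mulr_gt0.
have t1 : t <= 1 by nra.
have s0 : 0 <= eta ^+ 2 * B ^+ 2 / 2 by rewrite divr_ge0// mulr_ge0// sqr_ge0.
have {}H : t * ln (1 + eta ^+ 2 * B ^+ 2 / 2) <= eta * ((a + b) / 2 - m).
  apply: (le_trans (ln1D_ge s0 t0 t1)).
  have -> : t * (eta ^+ 2 * B ^+ 2 / 2) = (eta * (a - b) / 2) ^+ 2 / 2.
    have -> : (eta * (a - b) / 2) ^+ 2 = eta ^+ 2 * (a - b) ^+ 2 / 4 by field.
    by rewrite -tE; field.
  rewrite -ler_expR lnK ?posrE; last by rewrite ltr_pwDl// divr_ge0// sqr_ge0.
  by rewrite [eta * (_ - m)]mulrBr expRD -ler_pdivrMl ?expR_gt0// -expRN.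
have : lambda_bar eta B <= 4 * ln (1 + eta ^+ 2 * B ^+ 2 / 2) / (eta * B ^+ 2).
  by rewrite ge_min lexx.
rewrite ler_pdivlMr ?mulr_gt0// => L.
have {}L : lambda_bar eta B / 16 * (a - b) ^+ 2 * eta
    <= t * ln (1 + eta ^+ 2 * B ^+ 2 / 2).
  rewrite -tE; have := ler_wpM2l t0 L.
  by lra.
rewrite -(ler_pM2r eta0); lra.
Qed.

(** * Conditional expectations within one round *)

(** The estimate [loss_est] as a function of the losses [l] of a single round
    and of its draws [a] and [b]. *)
Definition round_est (R : realType) (n : nat) (l : 'I_n.+1 -> R)
    (a b i : 'I_n.+1) : R :=
  n.+1%:R * (b == i)%:R * l i + (1 - n.+1%:R * (b == i)%:R) * l a.

(** The expectation of [f i j] for independent [i] and [j], each equal to [a] or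
    [b] with probabilities proportional to [p a] and [p b]. No case distinction
    is needed for [a = b], where this is [f a a]. *)
Definition pair_mean (R : realType) (n : nat) (p : 'I_n.+1 -> R)
    (a b : 'I_n.+1) (f : 'I_n.+1 -> 'I_n.+1 -> R) : R :=
  (p a ^+ 2 * f a a + p a * p b * (f a b + f b a) + p b ^+ 2 * f b b)
  / (p a + p b) ^+ 2.

(** The conditional expectation of [f] over the draws of a round with weights
    [p], given the past (see [sum_step]). *)
Definition round_mean (R : realType) (n : nat) (p : 'I_n.+1 -> R)
    (f : draws n -> R) : R :=
  \sum_a \sum_b p a / n.+1%:R * pair_mean p a b (fun i j => f ((a, b), (i, j))).

(** In a sum over all ordered pairs, terms that are antisymmetric in the pair
    cancel; only the symmetrized summand has to be bounded. *)
Lemma sum_sym_le0 (R : realType) (I : finType) (F : I -> I -> R) :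
  (forall i j, F i j + F j i <= 0) -> \sum_i \sum_j F i j <= 0.
Proof.
move=> F0; have : \sum_i \sum_j (F i j + F j i) <= 0.
  by apply: sumr_le0 => i _; apply: sumr_le0 => j _; exact: F0.
under eq_bigr do rewrite big_split.
by rewrite big_split/= [X in _ + X]exchange_big/=; lra.
Qed.

Lemma pair_meanE (R : realType) (n : nat) (p : 'I_n.+1 -> R) (a b : 'I_n.+1)
    (f : 'I_n.+1 -> 'I_n.+1 -> R) : 0 < p a -> 0 < p b ->
  let q := p b / (p a + p b) in
  pair_mean p a b f
    = (1 - q) ^+ 2 * f a a + q * (1 - q) * (f a b + f b a) + q ^+ 2 * f b b.
Proof.
move=> pa pb; rewrite /pair_mean /=.
have /gt_eqF/negbT ab : 0 < p a + p b by rewrite addr_gt0.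
by field.
Qed.

Section Round.
Variables (R : realType) (n : nat) (p l : 'I_n.+1 -> R).
Hypotheses (p_gt0 : forall i, 0 < p i) (p_sum : \sum_i p i = 1).
Let K : R := n.+1%:R.

Let K_gt0 : 0 < K. Proof. by rewrite ltr0n. Qed.
Let K_ge1 : 1 <= K. Proof. by rewrite ler1n. Qed.

Let p_le1 i : p i <= 1.
Proof.
by rewrite -p_sum (bigD1 i)//= lerDl sumr_ge0// => j _; exact: ltW.
Qed.

Lemma round_mean_cst (c : R) : round_mean p (fun=> c) = c.
Proof.
rewrite /round_mean -[RHS]mul1r -[X in _ = X * _]p_sum mulr_suml; apply: eq_bigr => a _.
under eq_bigr => b _ do rewrite (@pair_meanE _ _ _ a b)//.
transitivity (\sum_(b < n.+1) (p a / K * c)).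
  by apply: eq_bigr => b _; rewrite /K; ring.
by rewrite sumr_const card_ord -mulr_natl mulrA mulrCA divff ?gt_eqF// mulr1.
Qed.

Lemma le_round_mean (f g : draws n -> R) :
  (forall a b, pair_mean p a b (fun i j => f ((a, b), (i, j))) <=
     pair_mean p a b (fun i j => g ((a, b), (i, j)))) ->
  round_mean p f <= round_mean p g.
Proof.
move=> fg; apply: ler_sum => a _; apply: ler_sum => b _.
by rewrite ler_wpM2l// divr_ge0// ltW.
Qed.

Variables (lambda : R).
Hypothesis (lambda_gt0 : 0 < lambda).
Hypothesis (small : forall i j, `|lambda * K * (l i - l j)| <= 1 / 100).

(** Only the estimate of [b] differs from [l a], so the potential moves by an
    exponential of [xi] that enters with the weight [p b] only. *)
Lemma round_potential_le (a b : 'I_n.+1) (xi := lambda * K * (l b - l a)) :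
  \sum_k p k * expR (- lambda * round_est l a b k
                     + lambda ^+ 2 * (round_est l a b k - l a) ^+ 2)
    <= expR (- lambda * l a + p b * (- xi + 3 * xi ^+ 2)).
Proof.
rewrite [leRHS]expRD (bigD1 b)//= (eq_bigr (fun k => p k * expR (- lambda * l a))).
  rewrite -mulr_suml; have -> : \sum_(i < n.+1 | i != b) p i = 1 - p b.
    by rewrite -[X in _ = X - _]p_sum [in RHS](bigD1 b)//= addrAC subrr add0r.
  have -> : - lambda * round_est l a b b
      + lambda ^+ 2 * (round_est l a b b - l a) ^+ 2
      = - lambda * l a + (- xi + xi ^+ 2).
    by rewrite /round_est eqxx /xi /K /=; ring.
  rewrite expRD mulrCA [_ * expR (- lambda * l a)]mulrC -mulrDr.
  rewrite ler_wpM2l ?expR_ge0//; apply: le_trans (expR_ge1Dx _).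
  have := ler_wpM2l (ltW (p_gt0 b)) (expR_add_sqr_le (small b a)).
  by rewrite -/xi; lra.
move=> k /negbTE kb; rewrite /round_est eq_sym kb /=; congr (_ * expR _); ring.
Qed.

(** Given [a], the estimate of [k] is unbiased over the uniform [b], and
    [expR (x - x ^+ 2) <= 1 + x] makes the exponential moment of the penalized
    estimate no larger than if the estimate were equal to its mean. *)
Lemma expert_round_le (k : 'I_n.+1) :
  round_mean p (fun d => expR (- lambda * l k + (lambda * round_est l d.1.1 d.1.2 k
    - lambda ^+ 2 * (round_est l d.1.1 d.1.2 k - l d.1.1) ^+ 2))) <= 1.
Proof.
rewrite -[leRHS]p_sum; apply: ler_sum => a _ /=.
rewrite -[leRHS]mulr1 -mulr_sumr.
under eq_bigr => b _ do rewrite (@pair_meanE _ _ _ a b)//=.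
set u := l k - l a.
apply: (@le_trans _ _ (p a / K * \sum_(b < n.+1)
    (expR (- (lambda * u)) * (1 + lambda * K * u * (b == k)%:R)))).
  apply: ler_wpM2l; first by rewrite divr_ge0 ?ltW.
  apply: ler_sum => b _; set e := expR (_ + _).
  rewrite [leLHS](_ : _ = e); last by ring.
  pose xi := lambda * K * u * (b == k)%:R.
  have xis : `|xi| <= 1 / 100.
    by rewrite /xi; case: (_ == _); rewrite /= ?mulr1 ?small// mulr0 normr0; lra.
  have -> : e = expR (- (lambda * u)) * expR (xi - xi ^+ 2).
    by rewrite -expRD /e /xi /u /round_est /K; congr expR; case: (b == k) => /=; ring.
  by rewrite ler_wpM2l ?expR_ge0// expR_sub_sqr_le.
rewrite -mulr_sumr big_split/= sumr_const card_ord -mulr_sumr.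
rewrite (bigD1 k)//= eqxx big1 ?addr0; last by move=> i /negbTE ->.
have -> : p a / K * (expR (- (lambda * u)) * (1 *+ n.+1 + lambda * K * u * 1%:R))
    = p a * (expR (- (lambda * u)) * (1 + lambda * u)).
  by rewrite -/K; field; rewrite gt_eqF.
rewrite ler_wpM2l//; first exact: ltW.
by rewrite expRN ler_pdivrMl ?expR_gt0// mulr1 expR_ge1Dx.
Qed.

(** The second-order expansion of the learner's exponent. It has two parts: [c]
    comes from the choice of [i] and [j], and the other one, which bounds the
    change of the potential, keeps its factor [y] (a weight) even in the
    quadratic term since [y ^+ 2 <= y]. *)
Lemma expR_add_small_le (y c xi : R) : 0 <= y -> y <= 1 ->
  `|c| <= 1 / 100 -> `|xi| <= 1 / 100 ->
  expR (c + y * (- xi + 3 * xi ^+ 2))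
    <= 1 + c + 12 / 5 * c ^+ 2 + y * (- xi + 6 * xi ^+ 2).
Proof.
move=> y0 y1; rewrite !ler_norml => /andP[c1 c2] /andP[x1 x2].
set w := y * (- xi + 3 * xi ^+ 2).
have w1 : w <= 1 / 50 by rewrite /w; nra.
apply: (le_trans (expR_le_quad _)); first by lra.
have w2 : 12 / 5 * w ^+ 2 <= y * (3 * xi ^+ 2).
  have -> : w ^+ 2 = y * (y * (1 - 3 * xi) ^+ 2 * xi ^+ 2) by rewrite /w; ring.
  rewrite mulrCA ler_wpM2l// mulrA ler_wpM2r ?sqr_ge0//; nra.
have := sqr_ge0 (c - w); rewrite /w in w2 *; lra.
Qed.

(** Once averaged over [i] and [j], the excess over 1 given the pair [(a, b)] is
    at most [g a b] below. Its first-order terms cancel when the pairs [(a, b)]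
    and [(b, a)] are added; the midpoint gain [mu] then exceeds all the
    second-order terms. *)
Lemma learner_round_le (mu : R) (z : 'I_n.+1 -> 'I_n.+1 -> R) :
  22 * lambda * K ^+ 2 <= mu ->
  (forall i j, `|mu * (l i - l j)| <= 1 / 16) ->
  (forall i j, z i j <= (l i + l j) / 2 - mu * (l i - l j) ^+ 2) ->
  round_mean p (fun d => expR (lambda * z d.2.1 d.2.2) *
    \sum_k p k * expR (- lambda * round_est l d.1.1 d.1.2 k
      + lambda ^+ 2 * (round_est l d.1.1 d.1.2 k - l d.1.1) ^+ 2)) <= 1.
Proof.
move=> lmu mus zle.
pose D a b := l b - l a.
pose q a b := p b / (p a + p b).
pose g a b := lambda * q a b * D a b
  - 2 * lambda * mu * (q a b * (1 - q a b)) * D a b ^+ 2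
  + p b * (- (lambda * K * D a b) + 6 * (lambda * K * D a b) ^+ 2)
  + 5 * lambda ^+ 2 * q a b * D a b ^+ 2.
pose S a b := \sum_k p k * expR (- lambda * round_est l a b k
      + lambda ^+ 2 * (round_est l a b k - l a) ^+ 2).
suff step a b : pair_mean p a b (fun i j => expR (lambda * z i j) * S a b)
    <= 1 + g a b.
  have -> : 1 = round_mean p (fun=> 1) by rewrite round_mean_cst.
  apply: (@le_trans _ _ (round_mean p (fun d => 1 + g d.1.1 d.1.2))).
    apply: le_round_mean => a b /=; apply: (le_trans (step a b)).
    by rewrite pair_meanE//; lra.
  rewrite -subr_le0 /round_mean -sumrB; under eq_bigr do rewrite -sumrB.
  apply: sum_sym_le0 => a b; rewrite !pair_meanE//=.
  rewrite /g /q /D -/K; set x := p a; set y := p b; set d := l b - l a.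
  have -> : l a - l b = - d by rewrite /d; ring.
  have [x0 y0] : 0 < x /\ 0 < y by split; exact: p_gt0.
  have [x1 y1] : x <= 1 /\ y <= 1 by split; exact: p_le1.
  have xy0 : x + y != 0 by rewrite gt_eqF// addr_gt0.
  have K0 : K != 0 by rewrite gt_eqF.
  (* The terms of first order in [d] have cancelled. *)
  rewrite [leLHS](_ : _ = x * y / (x + y) * d ^+ 2 * (lambda / K) *
    (12 * (x + y) * lambda * K ^+ 2 + 10 * lambda - 2 * mu)); last first.
    by field; rewrite nat1r -/K K0.
  have K2 : 1 <= K ^+ 2 by rewrite expr_ge1.
  have s0 : 0 <= x * y / (x + y) by rewrite divr_ge0 ?mulr_ge0 ?addr_ge0// ltW.
  have k0 : 0 <= lambda / K by rewrite divr_ge0// ltW.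
  rewrite mulr_ge0_le0// ?(mulr_ge0 (mulr_ge0 s0 (sqr_ge0 d)) k0)// {s0 k0}.
  have := ler_wpM2l (ltW lambda_gt0) K2.
  have : (x + y) * (lambda * K ^+ 2) <= 2 * (lambda * K ^+ 2).
    by rewrite ler_wpM2r ?mulr_ge0 ?sqr_ge0 ?(ltW lambda_gt0)//; lra.
  by move: lambda_gt0; lra.
pose y := p b; pose d := D a b; pose xi := lambda * K * d.
pose w := y * (- xi + 6 * xi ^+ 2).
have y0 : 0 <= y by exact: ltW (p_gt0 b).
have xis : `|xi| <= 1 / 100 by exact: small.
have lds : `|lambda * d| <= 1 / 100.
  apply: le_trans xis; rewrite /xi mulrAC [leRHS]normrM ler_peMr//.
  by rewrite (le_trans K_ge1)// ler_norm.
(* [c] is [lambda] times the excess over [l a] of the bound on [z i j]; it is 0,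
   [lambda * d * (1 / 2 - mu * d)] or [lambda * d] according to how many of [i]
   and [j] are equal to [b]. *)
have key c i j : lambda * ((l i + l j) / 2 - mu * (l i - l j) ^+ 2 - l a) = c ->
    `|c| <= 1 / 100 -> expR (lambda * z i j) * S a b <= 1 + c + 12 / 5 * c ^+ 2 + w.
  move=> cE cs; apply: le_trans (expR_add_small_le y0 (p_le1 b) cs xis).
  apply: (@le_trans _ _ (expR (lambda * z i j) *
      expR (- lambda * l a + y * (- xi + 3 * xi ^+ 2)))).
    by rewrite ler_wpM2l ?expR_ge0//; exact: round_potential_le.
  rewrite -expRD ler_expR -cE.
  by have := ler_wpM2l (ltW lambda_gt0) (zle i j); lra.
have mud : `|1 / 2 - mu * d| <= 1.
  have := mus b a; rewrite -/(D a b) -/d !ler_norml => /andP[? ?].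
  by apply/andP; split; lra.
pose c := lambda * d * (1 / 2 - mu * d).
have cs : `|c| <= `|lambda * d| by rewrite /c normrM ler_piMr.
have c2 : c ^+ 2 <= (lambda * d) ^+ 2.
  by rewrite -[leLHS]real_normK ?num_real// -[leRHS]real_normK ?num_real// lerXn2r.
have faa : expR (lambda * z a a) * S a b <= 1 + 0 + 12 / 5 * 0 ^+ 2 + w.
  by apply: key; [field|rewrite normr0; lra].
have fab : expR (lambda * z a b) * S a b <= 1 + c + 12 / 5 * c ^+ 2 + w.
  by apply: key; [rewrite /c /d /D; field|exact: le_trans cs lds].
have fba : expR (lambda * z b a) * S a b <= 1 + c + 12 / 5 * c ^+ 2 + w.
  by apply: key; [rewrite /c /d /D; field|exact: le_trans cs lds].
have fbb : expR (lambda * z b b) * S a b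
    <= 1 + lambda * d + 12 / 5 * (lambda * d) ^+ 2 + w.
  by apply: key; [rewrite /d /D; field|].
rewrite pair_meanE// -/(q a b) /g -/d -/y -/xi.
have q0 : 0 <= q a b by rewrite divr_ge0 ?addr_ge0// ltW.
have q1 : q a b <= 1 by rewrite ler_pdivrMr ?addr_gt0// mul1r lerDr ltW.
set t := q a b in q0 q1 *.
apply: (@le_trans _ _ ((1 - t) ^+ 2 * (1 + w) + t * (1 - t) *
   (2 * (1 + c + 12 / 5 * (lambda * d) ^+ 2 + w))
   + t ^+ 2 * (1 + lambda * d + 12 / 5 * (lambda * d) ^+ 2 + w))).
  apply: lerD; last by rewrite ler_wpM2l ?sqr_ge0.
  apply: lerD; first by rewrite ler_wpM2l ?sqr_ge0//; lra.
  apply: ler_wpM2l; first by rewrite mulr_ge0 ?subr_ge0.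
  have := lerD fab fba; move: c2; set C := c ^+ 2; set C' := (lambda * d) ^+ 2.
  by clearbody C C' w c; lra.
rewrite -subr_ge0 [X in 0 <= X](_ : _ =
  t * (lambda * d) ^+ 2 * (1 / 5 + 12 / 5 * t)); last by rewrite /w /c; field.
apply: mulr_ge0; last by lra.
by rewrite mulr_ge0 ?sqr_ge0.
Qed.
End Round.

(** * Products of conditionally bounded factors *)

(** The tower rule for a nonnegative supermartingale, summing out the last round
    first. Trajectories truncated after [m] rounds are represented by those that
    take a default value from round [m] on. *)
Lemma sum_prod_past_le1 (R : realType) (n T : nat)
    (h : trajectory n T -> 'I_T -> R) :
  (forall w t, 0 <= h w t) ->
  (forall (w w' : trajectory n T) (t : 'I_T),
    (forall s : 'I_T, (s <= t)%N -> w s = w' s) -> h w t = h w' t) ->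
  (forall w t, \sum_d h (set_draws w t d) t <= 1) ->
  \sum_w \prod_(t < T) h w t <= 1.
Proof.
move=> h0 hpast h1.
pose d0 : draws n := ((ord0, ord0), (ord0, ord0)).
pose P (m : nat) (w : trajectory n T) := [forall s : 'I_T, (m <= s)%N ==> (w s == d0)].
suff H m : (m <= T)%N -> \sum_(w | P m w) \prod_(t < T | (t < m)%N) h w t <= 1.
  apply: le_trans (H T (leqnn T)); rewrite le_eqVlt; apply/orP; left; apply/eqP.
  apply: eq_big => [w|w _]; last by apply: eq_bigl => t; rewrite ltn_ord.
  by apply/esym/forallP => s; rewrite leqNgt ltn_ord.
elim: m => [_|m IH mT].
  rewrite (big_pred1 [ffun=> d0]) ?big_pred0// => w /=.
  apply/forallP/eqP => [w0|-> s]; last by rewrite ffunE eqxx.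
  by apply/ffunP => s; rewrite ffunE; apply/eqP; exact: (w0 s).
pose t0 := Ordinal mT; apply: le_trans (IH (ltnW mT)).
rewrite (partition_big (fun w => set_draws w t0 d0) (P m)) /=; last first.
  move=> w /forallP Pw; apply/forallP => s; apply/implyP => ms; rewrite ffunE.
  case: (eqVneq s t0) => // st; apply: (implyP (Pw s)).
  by rewrite ltn_neqAle ms andbT eq_sym.
apply: ler_sum => v /forallP Pv.
rewrite (reindex_onto (set_draws v t0) (fun w => w t0)) /=; last first.
  move=> w /andP[_ /eqP <-]; apply/ffunP => s; rewrite !ffunE.
  by case: (eqVneq s t0) => // ->.
apply: (@le_trans _ _ (\sum_d (h (set_draws v t0 d) t0
   * \prod_(t < T | (t < m)%N) h v t))); last first.
  by rewrite -mulr_suml ler_piMl// prodr_ge0.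
rewrite le_eqVlt; apply/orP; left; apply/eqP; apply: eq_big => [d|d _].
  rewrite !ffunE !eqxx andbT; apply/andP; split.
    apply/forallP => s; apply/implyP => ms; rewrite ffunE.
    case: (eqVneq s t0) => [st|_]; first by rewrite st ltnn in ms.
    by apply: (implyP (Pv s)); exact: ltnW.
  apply/eqP/ffunP => s; rewrite !ffunE; case: (eqVneq s t0) => // ->.
  by apply/esym/eqP; apply: (implyP (Pv t0)).
rewrite (bigD1 t0)//=; congr (_ * _); apply: eq_big => [t|t].
  by rewrite -val_eqE /= ltnS ltn_neqAle andbC.
rewrite -val_eqE /= ltnS => /andP[tm tm'].
apply: hpast => s st; rewrite ffunE ifF//.
by apply/negbTE; rewrite -val_eqE /= ltn_eqF// (leq_ltn_trans st)// ltn_neqAle tm' tm.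
Qed.

(** * Exponential moments of the regret *)

Section Analysis.
Variables (R : realType) (n T : nat) (l : 'I_n.+1 -> 'I_T -> R) (lambda : R).
Let K : R := n.+1%:R.
Implicit Types (w : trajectory n T) (t : 'I_T).

Lemma weight_gt0 w t i : 0 < weight l lambda w t i.
Proof. exact: expR_gt0. Qed.

Lemma sum_weight_gt0 w t : 0 < \sum_j weight l lambda w t j.
Proof.
rewrite (bigD1 ord0)//= ltr_pwDl ?weight_gt0//.
by apply: sumr_ge0 => i _; exact/ltW/weight_gt0.
Qed.

Lemma p_hat_gt0 w t i : 0 < p_hat l lambda w t i.
Proof. by rewrite divr_gt0 ?weight_gt0 ?sum_weight_gt0. Qed.

Lemma sum_p_hat w t : \sum_i p_hat l lambda w t i = 1.
Proof. by rewrite -mulr_suml divff// gt_eqF ?sum_weight_gt0. Qed.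

Lemma p_hat_past w w' t : (forall s : 'I_T, (s < t)%N -> w s = w' s) ->
  p_hat l lambda w t =1 p_hat l lambda w' t.
Proof.
move=> ww' i; rewrite /p_hat !(weight_past _ _ ww'); congr (_ / _).
by apply: eq_bigr => j _; exact: weight_past.
Qed.

Lemma set_draws_past w t d (s : 'I_T) : (s < t)%N -> set_draws w t d s = w s.
Proof. by move=> st; rewrite ffunE -val_eqE /= ltn_eqF. Qed.

Lemma loss_estE w i t :
  loss_est l w i t = round_est (l^~ t) (drawA w t) (drawB w t) i.
Proof. by []. Qed.

(** If [a = b] the sums over [[set a; b]] have one term instead of two, but on the
    right-hand side both the numerator and the denominator are then doubled. *)
Lemma sum_pair_choice (u : 'I_n.+1 -> R) (a b : 'I_n.+1) (g : 'I_n.+1 -> R) :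
  (forall i, 0 < u i) ->
  \sum_i (if i \in [set a; b]%SET then u i / \sum_(j in [set a; b]%SET) u j else 0) * g i
  = (u a * g a + u b * g b) / (u a + u b).
Proof.
move=> u0.
rewrite (eq_bigr (fun i => if i \in [set a; b]%SET then
  u i * g i / \sum_(j in [set a; b]%SET) u j else 0)); last first.
  by move=> i _; case: ifP => _; rewrite ?mul0r// mulrAC.
rewrite -big_mkcond -mulr_suml.
have [->|ab] := eqVneq a b.
  rewrite finset.setUid !big_set1 -!mulr2n -[u b *+ 2]mulr_natr -[_ *+ 2]mulr_natr.
  by field; rewrite gt_eqF// u0.
by rewrite !big_setU1 ?inE//= !big_set1.
Qed.

Lemma sum_step (w : trajectory n T) t (f : draws n -> R) :
  \sum_d step_mass l lambda (set_draws w t d) t * f d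
    = round_mean (p_hat l lambda w t) f.
Proof.
pose u := weight l lambda w t.
have u0 i : 0 < u i by exact: weight_gt0.
have ew d : weight l lambda (set_draws w t d) t =1 u.
  by apply: weight_past => s st; exact: set_draws_past.
pose q (a b i : 'I_n.+1) :=
  if i \in [set a; b]%SET then u i / \sum_(j in [set a; b]%SET) u j else 0.
transitivity (\sum_(d : draws n) (p_hat l lambda w t d.1.1 * K^-1)
    * (q d.1.1 d.1.2 d.2.1 * q d.1.1 d.1.2 d.2.2)
    * f ((d.1.1, d.1.2), (d.2.1, d.2.2))).
  apply: eq_bigr => d _; rewrite -!surjective_pairing.
  rewrite /step_mass /p_hat /q_hat /observed /drawA /drawB /drawI /drawJ.
  rewrite !ffunE eqxx !ew (eq_bigr _ (fun i _ => ew d i)).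
  by rewrite (eq_bigr _ (fun i _ => ew d i)).
rewrite -(pair_bigA _ (fun ab ij => (p_hat l lambda w t ab.1 * K^-1)
    * (q ab.1 ab.2 ij.1 * q ab.1 ab.2 ij.2) * f ((ab.1, ab.2), (ij.1, ij.2))))/=.
rewrite -(pair_bigA _ (fun a b => \sum_ij (p_hat l lambda w t a * K^-1)
    * (q a b ij.1 * q a b ij.2) * f ((a, b), (ij.1, ij.2))))/=.
apply: eq_bigr => a _; apply: eq_bigr => b _.
rewrite -(pair_bigA _ (fun i j => (p_hat l lambda w t a * K^-1)
    * (q a b i * q a b j) * f ((a, b), (i, j))))/=.
transitivity (p_hat l lambda w t a * K^-1 *
    \sum_i q a b i * \sum_j q a b j * f ((a, b), (i, j))).
  rewrite mulr_sumr; apply: eq_bigr => i _; rewrite mulrA mulr_sumr.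
  by apply: eq_bigr => j _; rewrite !mulrA.
congr (_ * _); rewrite sum_pair_choice// !sum_pair_choice//.
rewrite /pair_mean /p_hat -/(u a) -/(u b).
by field; rewrite !gt_eqF ?addr_gt0// sum_weight_gt0.
Qed.

Lemma step_mass_ge0 w t : 0 <= step_mass l lambda w t.
Proof.
have q0 i : 0 <= q_hat l lambda w t i.
  rewrite /q_hat; case: ifP => // _.
  by rewrite divr_ge0 ?sumr_ge0// => *; exact/ltW/weight_gt0.
apply: mulr_ge0; last exact: mulr_ge0.
by apply: mulr_ge0; rewrite ?invr_ge0//; exact/ltW/p_hat_gt0.
Qed.

Definition growth (w : trajectory n T) (k : 'I_n.+1) (t : 'I_T) : R :=
  expR (- lambda * loss_est l w k t + lambda ^+ 2 * var_est l w k t).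

Definition potential_ratio (w : trajectory n T) (t : 'I_T) : R :=
  \sum_k p_hat l lambda w t k * growth w k t.

Lemma growth_gt0 w k t : 0 < growth w k t. Proof. exact: expR_gt0. Qed.

Lemma potential_ratio_ge0 w t : 0 <= potential_ratio w t.
Proof.
by apply: sumr_ge0 => k _; rewrite mulr_ge0// ltW// ?p_hat_gt0 ?growth_gt0.
Qed.

Lemma weightE w t k :
  weight l lambda w t k = \prod_(s < T | (s < t)%N) growth w k s.
Proof.
by rewrite /weight /cum_loss_est /cum_var_est !mulr_sumr -big_split/= expR_sum.
Qed.

(** The [potential_ratio] of a round is the ratio of the total weights after and
    before it, so that the right-hand side is the final total weight, starting
    from [K]; the left-hand side is the final weight of [k] alone. *)
Lemma prod_growth_le w k :
  \prod_(t < T) growth w k t <= K * \prod_(t < T) potential_ratio w t.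
Proof.
suff H m : (m <= T)%N -> \sum_i \prod_(t < T | (t < m)%N) growth w i t
    = K * \prod_(t < T | (t < m)%N) potential_ratio w t.
  have := H T (leqnn T).
  have allT (F : 'I_T -> R) : \prod_(t < T | (t < T)%N) F t = \prod_(t < T) F t.
    by apply: eq_bigl => t; rewrite ltn_ord.
  rewrite allT => <-; rewrite (bigD1 k)//= allT lerDl sumr_ge0// => i _.
  by rewrite prodr_ge0// => t _; exact/ltW/growth_gt0.
elim: m => [_|m IH mT].
  rewrite (eq_bigr (fun=> 1)) => [|i _]; last by rewrite big_pred0.
  by rewrite [X in K * X]big_pred0// sumr_const card_ord mulr1.
pose t0 := Ordinal mT.
have split_last (F : 'I_T -> R) : \prod_(t < T | (t < m.+1)%N) F t
    = F t0 * \prod_(t < T | (t < m)%N) F t.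
  rewrite (bigD1 t0)//=; congr (_ * _); apply: eq_bigl => t.
  by rewrite -val_eqE /= ltnS ltn_neqAle andbC.
rewrite split_last mulrCA -IH; last exact: ltnW.
under eq_bigr do rewrite split_last.
rewrite /potential_ratio mulr_suml; apply: eq_bigr => i _.
rewrite /p_hat weightE (eq_bigr _ (fun j _ => weightE w t0 j))/=.
have S0 : \sum_j \prod_(t < T | (t < m)%N) growth w j t != 0.
  rewrite gt_eqF// -(eq_bigr _ (fun j _ => weightE w t0 j)).
  exact: sum_weight_gt0.
by rewrite mulrAC mulfVK// mulrC.
Qed.

Variables (z : 'I_n.+1 -> 'I_n.+1 -> 'I_T -> R) (k : 'I_n.+1).

(** Half-sum of a factor for the learner and a factor for the expert [k]; taking
    the half-sum, rather than controlling each family separately, makes a single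
    application of Markov's inequality suffice. *)
Definition round_factor (w : trajectory n T) (t : 'I_T) : R :=
  (expR (lambda * z (drawI w t) (drawJ w t) t) * potential_ratio w t
   + expR (- lambda * l k t) / growth w k t) / 2.

Lemma round_factor_ge0 w t : 0 <= round_factor w t.
Proof.
rewrite divr_ge0// addr_ge0//.
  by rewrite mulr_ge0 ?expR_ge0 ?potential_ratio_ge0.
by rewrite divr_ge0 ?expR_ge0//; exact/ltW/growth_gt0.
Qed.

Lemma round_factor_past w w' t : (forall s : 'I_T, (s <= t)%N -> w s = w' s) ->
  round_factor w t = round_factor w' t.
Proof.
move=> ww'; have wt := ww' t (leqnn t).
have gE i : growth w i t = growth w' i t.
  by rewrite /growth /var_est /loss_est /drawA /drawB wt.
rewrite /round_factor /drawI /drawJ wt gE; congr ((_ * _ + _) / 2).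
apply: eq_bigr => i _; rewrite gE (@p_hat_past w w')// => s /ltnW; exact: ww'.
Qed.

(** The square of the half-sum dominates the product of both factors, and
    the [growth] factors of [k] are absorbed by [prod_growth_le]. *)
Lemma prod_round_factor_ge w :
  expR (lambda * (\sum_t z (drawI w t) (drawJ w t) t - \sum_t l k t))
    <= K * (\prod_t round_factor w t) ^+ 2.
Proof.
apply: (@le_trans _ _ (K * \prod_t
    ((expR (lambda * z (drawI w t) (drawJ w t) t) * potential_ratio w t)
     * (expR (- lambda * l k t) / growth w k t)))); last first.
  rewrite ler_pM2l ?ltr0n// -prodrXl; apply: ler_prod => t _; apply/andP; split.
    rewrite !mulr_ge0 ?expR_ge0 ?potential_ratio_ge0 ?invr_ge0//.
    exact/ltW/growth_gt0.
  rewrite /round_factor; set a := expR _ * _; set b := expR _ / _.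
  by have := sqr_ge0 (a - b); lra.
have g0 : 0 < \prod_t growth w k t by apply: prodr_gt0 => t _; exact: growth_gt0.
move: g0 (prod_growth_le w k); rewrite !big_split/= prodfV mulrACA.
move: (\prod_t growth w k t) => g g0 gle.
rewrite -!expR_sum -!mulr_sumr -expRD mulNr -mulrBr [leRHS]mulrCA.
by rewrite ler_peMr ?expR_ge0// mulrA ler_pdivlMr// mul1r.
Qed.

Hypothesis (lambda_gt0 : 0 < lambda).
Hypothesis (small : forall i j t, `|lambda * K * (l i t - l j t)| <= 1 / 100).
Variable (mu : R).
Hypothesis (lambda_mu : 22 * lambda * K ^+ 2 <= mu).
Hypothesis (mu_small : forall i j t, `|mu * (l i t - l j t)| <= 1 / 16).
Hypothesis (z_le : forall i j t,
  z i j t <= (l i t + l j t) / 2 - mu * (l i t - l j t) ^+ 2).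

Lemma sum_step_round_factor_le w t :
  \sum_d step_mass l lambda (set_draws w t d) t * round_factor (set_draws w t d) t
    <= 1.
Proof.
pose p := p_hat l lambda w t.
have p0 i : 0 < p i by exact: p_hat_gt0.
have p1 : \sum_i p i = 1 by exact: sum_p_hat.
pose A (d : draws n) := expR (lambda * z d.2.1 d.2.2 t) *
  \sum_i p i * expR (- lambda * round_est (l^~ t) d.1.1 d.1.2 i
    + lambda ^+ 2 * (round_est (l^~ t) d.1.1 d.1.2 i - l d.1.1 t) ^+ 2).
pose C (d : draws n) := expR (- lambda * l k t + (lambda * round_est (l^~ t) d.1.1 d.1.2 k
    - lambda ^+ 2 * (round_est (l^~ t) d.1.1 d.1.2 k - l d.1.1 t) ^+ 2)).
have E d : round_factor (set_draws w t d) t = (A d + C d) / 2.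
  have dt : set_draws w t d t = d by rewrite ffunE eqxx.
  rewrite /round_factor /potential_ratio /growth /var_est.
  under eq_bigr => i _ do rewrite (p_hat_past (fun s => @set_draws_past w t d s)).
  under eq_bigr do rewrite !loss_estE.
  rewrite !loss_estE /drawA /drawB /drawI /drawJ dt -expRN -expRD -/(A d).
  by congr ((_ + expR _) / 2); ring.
have -> : \sum_d step_mass l lambda (set_draws w t d) t * round_factor (set_draws w t d) t
    = (round_mean p A + round_mean p C) / 2.
  rewrite -!sum_step -big_split mulr_suml; apply: eq_bigr => d _.
  by rewrite E /=; ring.
have hA : round_mean p A <= 1.
  exact: (@learner_round_le _ _ p (l^~ t) p0 p1 lambda lambda_gt0
    (fun i j => small i j t) mu (fun i j => z i j t)).
have hC : round_mean p C <= 1.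
  exact: (@expert_round_le _ _ p (l^~ t) p0 p1 lambda (fun i j => small i j t) k).
lra.
Qed.

(** Markov's inequality for the product of the [round_factor]s, whose expectation
    is at most 1: outside the event this product exceeds [delta^-1]. *)
Lemma regret_tail (delta : R) : 0 < delta ->
  1 - delta <= run_prob l lambda
    (fun w => \sum_t z (drawI w t) (drawJ w t) t - \sum_t l k t
       <= (ln K - 2 * ln delta) / lambda).
Proof.
move=> delta0.
pose good w := \sum_t z (drawI w t) (drawJ w t) t - \sum_t l k t
  <= (ln K - 2 * ln delta) / lambda.
change (1 - delta <= \sum_(w | good w) run_mass l lambda w).
have := run_mass_sum l lambda; rewrite (bigID good)/= => tot.
suff : \sum_(w | ~~ good w) run_mass l lambda w <= delta by lra.
pose M w := \prod_t round_factor w t.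
have M0 w : 0 <= M w by apply: prodr_ge0 => t _; exact: round_factor_ge0.
have EM : \sum_w run_mass l lambda w * M w <= 1.
  under eq_bigr do rewrite -big_split/=.
  apply: (@sum_prod_past_le1 _ _ _
    (fun w t => step_mass l lambda w t * round_factor w t)).
  - by move=> w t; exact: mulr_ge0 (step_mass_ge0 w t) (round_factor_ge0 w t).
  - move=> w w' t ww'.
    by rewrite (step_mass_past l lambda ww') (round_factor_past ww').
  - exact: sum_step_round_factor_le.
apply: (@le_trans _ _ (\sum_(w | ~~ good w) delta * (run_mass l lambda w * M w))).
  apply: ler_sum => w; rewrite /good -ltNge => bad.
  rewrite mulrCA ler_peMr ?run_mass_ge0//.
  have := prod_round_factor_ge w; rewrite -/(M w).
  set r := (\sum_t z _ _ t - _) in bad *.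
  have {}bad : K / delta ^+ 2 < expR (lambda * r).
    have -> : K / delta ^+ 2 = expR (ln K - 2 * ln delta).
      by rewrite expRB expRM_natl !lnK ?posrE// ltr0n.
    by rewrite ltr_expR [lambda * r]mulrC -ltr_pdivrMr.
  move=> /(lt_le_trans bad).
  rewrite -/K ltr_pM2l ?ltr0n// -[_^-1]mul1r ltr_pdivrMr ?exprn_gt0// => M1.
  rewrite leNgt; apply/negP => dM1.
  have dM0 : 0 <= delta * M w by rewrite mulr_ge0// ltW.
  have : M w ^+ 2 * delta ^+ 2 = (delta * M w) ^+ 2 by ring.
  nra.
rewrite -mulr_sumr ler_piMr ?(ltW delta0)//; apply: le_trans EM.
rewrite [leRHS](bigID good)/= lerDr sumr_ge0// => w _.
exact: mulr_ge0 (run_mass_ge0 _ _ _) (M0 w).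
Qed.

End Analysis.

(** * The regret bound *)

Lemma bigmin_attained (R : realType) (n : nat) (f : 'I_n.+1 -> R) :
  exists k, \big[Num.min / f ord0]_(i < n.+1) f i = f k.
Proof.
apply: (big_ind (fun x => exists k, x = f k)); [by exists ord0| |by move=> i; exists i].
by move=> _ _ [i ->] [j ->]; case: (leP (f i) (f j)) => _; [exists i|exists j].
Qed.

Lemma le_run_prob (R : realType) (n T : nat) (l : 'I_n.+1 -> 'I_T -> R)
    (lambda : R) (P Q : pred (trajectory n T)) :
  (forall w, P w -> Q w) -> run_prob l lambda P <= run_prob l lambda Q.
Proof.
move=> PQ; rewrite /run_prob big_mkcond [leRHS]big_mkcond.
apply: ler_sum => w _; case: ifPn => [/PQ ->//|_].
by case: ifP => // _; exact: run_mass_ge0.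
Qed.

Theorem theorem4p2 (R : realType) :
  exists c : R,
    forall (E : topologicalLmodType R) (X : set E) (Y : Type)
      (loss : E -> Y -> R) (B eta : R)
      (n T : nat) (y : 'I_T -> Y) (F : 'I_n.+1 -> 'I_T -> E)
      (lambda delta : R),
    closed X -> convex_set X ->
    0 < B -> 0 < eta ->
    (forall v : Y, exp_concave eta X (loss^~ v)) ->
    (forall (v : Y) (x x' : E), X x -> X x' -> `|loss x v - loss x' v| <= B) ->
    (forall (i : 'I_n.+1) (t : 'I_T), X (F i t)) ->
    let K : R := n.+1%:R in
    let lbar := lambda_bar eta B in
    0 < lambda < lbar / (352 * K ^+ 2) ->
    0 < delta < 1 ->
    1 - 8 * delta <=
      run_prob (expert_loss loss y F) lambda
        (fun w => regret loss y F w <=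
           c * (1 / lambda + K / lbar) * ln (lbar * K / (lambda * delta))).
Proof.
exists 2 => E X Y loss B eta n T y F lambda delta _ _ B0 eta0 lossX lossB FX K lbar.
move=> /andP[l0 lK] /andP[d0 d1].
pose l := expert_loss loss y F.
have [k minE] := bigmin_attained (fun i => \sum_t l i t).
have K1 : 1 <= K by rewrite /K ler1n.
have K0 : 0 < K by rewrite ltr0n.
have K2 : K <= K ^+ 2 by rewrite expr2 ler_peMr ?(ltW K0).
have lK2 : lambda * (352 * K ^+ 2) < lbar.
  by rewrite -ltr_pdivlMr// mulr_gt0// exprn_gt0.
have lb0 : 0 < lbar.
  by apply: lt_trans lK2; rewrite mulr_gt0// mulr_gt0// exprn_gt0.
have lbB : lbar * B <= 1.
  by rewrite -ler_pdivlMr// /lbar /lambda_bar ge_min lexx orbT.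
have lB i j t : `|l i t - l j t| <= B by exact: lossB.
have lKB : lambda * K * B <= 1 / 100.
  have h1 : lambda * K <= lambda * K ^+ 2 by rewrite ler_wpM2l// ltW.
  have h2 : lambda * K * 352 <= lbar by lra.
  have := ler_wpM2r (ltW B0) h2; lra.
have small i j t : `|lambda * K * (l i t - l j t)| <= 1 / 100.
  have lK0 : 0 <= lambda * K by rewrite mulr_ge0 ?(ltW l0) ?(ltW K0).
  by apply: le_trans lKB; rewrite normrM ger0_norm// ler_wpM2l.
have mu_small i j t : `|lbar / 16 * (l i t - l j t)| <= 1 / 16.
  rewrite normrM ger0_norm; last by rewrite divr_ge0// ltW.
  have := ler_wpM2l (ltW lb0) (lB i j t); lra.
have z_le i j t : loss (2^-1 *: F i t + 2^-1 *: F j t) (y t)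
    <= (l i t + l j t) / 2 - lbar / 16 * (l i t - l j t) ^+ 2.
  exact: (midpoint_exp_concave B0 eta0 (lossX (y t)) (FX i t) (FX j t) (lB i j t)).
have lambda_mu : 22 * lambda * n.+1%:R ^+ 2 <= lbar / 16 by rewrite -/K; lra.
have H := @regret_tail _ _ _ l lambda
  (fun i j t => loss (2^-1 *: F i t + 2^-1 *: F j t) (y t)) k l0 small (lbar / 16)
  lambda_mu mu_small z_le delta d0.
apply: (@le_trans _ _ (1 - delta)); first by lra.
apply: (le_trans H); apply: le_run_prob => w /=.
rewrite /regret minE -/l lerBlDr => /le_trans Hw; rewrite lerBlDr; apply: Hw.
rewrite lerD2r -/K.
have l1 : 1 <= lbar / lambda.
  rewrite ler_pdivlMr// mul1r; have := K1; nra.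
have -> : lbar * K / (lambda * delta) = lbar / lambda * (K / delta).
  by field; rewrite !gt_eqF.
have Kd : 1 <= K / delta by rewrite ler_pdivlMr// mul1r; lra.
rewrite (@lnM _ (lbar / lambda) (K / delta)) ?posrE ?(lt_le_trans ltr01)//.
rewrite (@ln_div _ K delta) ?posrE//.
have a0 := ln_ge0 l1; have b0 := ln_ge0 K1.
have c0 : ln delta <= 0 by rewrite ln_le0// ltW.
rewrite -(mulrC lambda^-1) mul1r.
apply: (@le_trans _ _ (lambda^-1 * (2 * (ln (lbar / lambda) + (ln K - ln delta))))).
  by rewrite ler_wpM2l ?invr_ge0 ?(ltW l0)//; lra.
set L := ln (lbar / lambda) + _.
have L0 : 0 <= L by rewrite /L; lra.
have e0 : 0 <= K / lbar by rewrite divr_ge0// ltW.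
by have := mulr_ge0 e0 L0; lra.
Qed.
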